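(* Let $(X^s_*(\cdot),U^s_*(\cdot))$ be the optimal stationary pair described in the context. There exist symmetric and positive definite matrices $S\in\mathbb{R}^{n\times n}$, $H\in\mathbb{R}^{(n+l)\times(n+l)}$ such that for every control process $U(\cdot)$ with corresponding state process $X(\cdot)=X_U(\cdot,X_0)$ and every $k\in\mathbb{N}_0$, $$\ell(X(k),U(k))-\ell(X^s_*(k),U^s_*(k))+\tilde\lambda(k,X(k))-\tilde\lambda(k+1,X(k+1))=\mathbb{E}\Big[\big\|(X(k)-X^s_*(k),\,U(k)-U^s_*(k))\big\|_H^2\Big],$$ where $$\tilde\lambda(k,X(k)):=-\mathbb{E}\big[\|X(k)\|_P^2-\|X(k)-X^s_*(k)\|_P^2\big]+\mathbb{E}\big[\|X(k)-X^s_*(k)\|_S^2\big].$$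
   Context: Setting. Let $A\in\mathbb{R}^{n\times n}$, $B\in\mathbb{R}^{n\times l}$ with $(A,B)$ stabilizable; $R\in\mathbb{R}^{l\times l}$ symmetric positive definite; $Q\in\mathbb{R}^{n\times n}$ symmetric positive semidefinite with $(A,Q^{1/2})$ detectable. On a probability space $(\Omega,\mathcal{F},\mathbb{P})$ consider $$X(k+1)=AX(k)+BU(k)+W(k),\quad X(0)=X_0,\qquad k\in\mathbb{N}_0,$$ where $W(k)\sim\mathcal{N}(0,\Sigma_W)$ are i.i.d. $\mathbb{R}^n$-valued Gaussian random variables with zero mean and covariance $\Sigma_W$, and $X_0\sim\mathcal{N}(\mu_0,\Sigma_0)$. A control process is a sequence $U(\cdot)$ with $U(k)\in L^2(\Omega,\mathcal{F}_k,\mathbb{P},\mathbb{R}^l)$, where $\mathcal{F}_k=\sigma(X(0),\ldots,X(k))$ is the filtration generated by the corresponding state process; also $X(k)\in L^2(\Omega,\mathcal{F}_k,\mathbb{P},\mathbb{R}^n)$. It is a standing assumption that for every state and control process under consideration $W(k)$ is independent of $(X(k),U(k))$ for all $k$ (this also applies to the stationary pair $(X^s_*(\cdot),U^s_*(\cdot))$). The solution is denoted $X_U(\cdot,X_0)$, or $X(\cdot)$ for short. Notation: $\|x\|_M^2:=x^TMx$ for a symmetric positive semidefinite matrix $M$; $(x,u)$ is the stacked vector in $\mathbb{R}^{n+l}$. Stage cost: $\ell(X,U):=\mathbb{E}[\|X\|_Q^2+\|U\|_R^2]$. Let $P$ be the unique positive semidefinite solution of $P=A^TPA+Q-A^TPB[R+B^TPB]^{-1}B^TPA$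 and $K:=-[R+B^TPB]^{-1}B^TPA$ (so $A+BK$ is Schur-stable). Optimal stationary pair: $U^s_*(k)=KX^s_*(k)$, $X^s_*(k+1)=(A+BK)X^s_*(k)+W(k)$ (with the same noise process $W(\cdot)$ that drives the system $X(k+1)=AX(k)+BU(k)+W(k)$), $X^s_*(0)\sim\mathcal{N}(0,\Sigma^s_* )$, where $\Sigma^s_*$ is the solution of $\Sigma^s_*=(A+BK)\Sigma^s_*(A+BK)^T+\Sigma_W$; thus $X^s_*(k)\sim\mathcal{N}(0,\Sigma^s_* )$ for all $k$. *)

(* Defs.v *)
From HB Require Import structures.
From mathcomp Require Import all_boot all_order all_algebra.
From mathcomp Require Import complex.
From mathcomp Require Import all_classical all_reals all_analysis.

Set Implicit Arguments.
Unset Strict Implicit.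
Unset Printing Implicit Defensive.

Import Order.TTheory GRing.Theory Num.Theory.
Import numFieldNormedType.Exports.

Local Open Scope classical_set_scope.
Local Open Scope ring_scope.

Section LinearQuadratic.
Context {R : realType}.

Definition normsq n (M : 'M[R]_n) (x : 'cV[R]_n) : R :=
  (x^T *m M *m x) ord0 ord0.

Definition psdmx n (M : 'M[R]_n) : Prop :=
  M^T = M /\ forall x : 'cV[R]_n, 0 <= normsq M x.

Definition pdmx n (M : 'M[R]_n) : Prop :=
  M^T = M /\ forall x : 'cV[R]_n, x != 0 -> 0 < normsq M x.

(* C is the principal square root of M, written M^(1/2). *)
Definition is_sqrtmx n (M C : 'M[R]_n) : Prop := psdmx C /\ C *m C = M.

(* All complex eigenvalues lie in the open unit disk. *)
Definition schur_stable n (A : 'M[R]_n) : Prop :=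
  forall z : complex R, eigenvalue (map_mx (real_complex R) A) z -> `|z| < 1.

Definition stabilizable n l (A : 'M[R]_n) (B : 'M[R]_(n, l)) : Prop :=
  exists F : 'M[R]_(l, n), schur_stable (A + B *m F).

Definition detectable n m (A : 'M[R]_n) (C : 'M[R]_(m, n)) : Prop :=
  exists L : 'M[R]_(n, m), schur_stable (A + L *m C).

Definition riccati_eq n l (A : 'M[R]_n) (B : 'M[R]_(n, l)) (Q : 'M[R]_n)
    (Rc : 'M[R]_l) (P : 'M[R]_n) : Prop :=
  P = A^T *m P *m A + Q
      - A^T *m P *m B *m invmx (Rc + B^T *m P *m B) *m B^T *m P *m A.

Definition lq_gain n l (A : 'M[R]_n) (B : 'M[R]_(n, l)) (Rc : 'M[R]_l)
    (P : 'M[R]_n) : 'M[R]_(l, n) :=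
  - (invmx (Rc + B^T *m P *m B) *m B^T *m P *m A).

End LinearQuadratic.

(* A random vector is a function T -> 'cV[R]_n; all measurability notions are
   stated on its real coordinates, which generate the Borel sets of R^n. *)
Section RandomVectors.
Context {d : measure_display} {T : measurableType d} {R : realType}.

Definition random_vector n (X : T -> 'cV[R]_n) : Prop :=
  forall i, measurable_fun [set: T] (fun w => X w i ord0).

Definition coord_events n (X : T -> 'cV[R]_n) : set (set T) :=
  \bigcup_i preimage_set_system [set: T] (fun w => X w i ord0) measurable.

Definition sigma_vec n (X : T -> 'cV[R]_n) : set (set T) :=
  <<s coord_events X >>.

Definition natural_filtration n (X : nat -> T -> 'cV[R]_n) (k : nat) :
    set (set T) :=
  <<s \bigcup_(j in [set j | (j <= k)%N]) coord_events (X j) >>.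

Definition measurable_wrt n (F : set (set T)) (X : T -> 'cV[R]_n) : Prop :=
  forall i (B : set R), measurable B -> F ((fun w => X w i ord0) @^-1` B).

Context (Pr : probability T R).

Definition square_integrable n (X : T -> 'cV[R]_n) : Prop :=
  forall i, (fun w => X w i ord0) \in Lfun Pr 2%:E.

Definition indep_vec n m (X : T -> 'cV[R]_n) (Y : T -> 'cV[R]_m) : Prop :=
  forall E F, sigma_vec X E -> sigma_vec Y F ->
    Pr (E `&` F) = (Pr E * Pr F)%E.

Definition mutually_indep n (W : nat -> T -> 'cV[R]_n) : Prop :=
  forall (s : seq nat) (E : nat -> set T), uniq s ->
    (forall k, k \in s -> sigma_vec (W k) (E k)) ->
    Pr (\bigcap_(k in [set` s]) E k) = (\prod_(k <- s) Pr (E k))%E.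

(* N(m, v) on the line with v the variance. The case v = 0 is separated because
   normal_prob m 0 is a dummy value and not the Dirac mass at m. *)
Definition gauss_law (m v : R) : set R -> \bar R :=
  if v == 0 then \d_m else normal_prob m (Num.sqrt v).

(* X ~ N(mu, Sigma), with Sigma possibly singular: every linear functional a of
   X has law N(a^T mu, a^T Sigma a). *)
Definition gaussian_vec n (mu : 'cV[R]_n) (Sigma : 'M[R]_n)
    (X : T -> 'cV[R]_n) : Prop :=
  [/\ random_vector X, psdmx Sigma &
      forall (a : 'cV[R]_n) (D : set R), measurable D ->
        Pr ((fun w => (a^T *m X w) ord0 ord0) @^-1` D) =
        gauss_law ((a^T *m mu) ord0 ord0) (normsq Sigma a) D].

(* The N(0, SigmaW) marginals make the sequence identically distributed. *)
Definition iid_gaussian_noise n (SigmaW : 'M[R]_n) (W : nat -> T -> 'cV[R]_n) :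
    Prop :=
  mutually_indep W /\ forall k, gaussian_vec 0 SigmaW (W k).

Fixpoint state_process n l (A : 'M[R]_n) (B : 'M[R]_(n, l))
    (W : nat -> T -> 'cV[R]_n) (X0 : T -> 'cV[R]_n) (U : nat -> T -> 'cV[R]_l)
    (k : nat) : T -> 'cV[R]_n :=
  if k is j.+1 then
    fun w => A *m state_process A B W X0 U j w + B *m U j w + W j w
  else X0.

Definition noise_indep n l (W : nat -> T -> 'cV[R]_n)
    (X : nat -> T -> 'cV[R]_n) (U : nat -> T -> 'cV[R]_l) : Prop :=
  forall k, indep_vec (W k) (fun w => col_mx (X k w) (U k w)).

(* U(k) is in L^2 of the filtration generated by the state process that U itself
   drives, and W(k) is independent of (X(k), U(k)). *)
Definition control_process n l (A : 'M[R]_n) (B : 'M[R]_(n, l))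
    (W : nat -> T -> 'cV[R]_n) (X0 : T -> 'cV[R]_n) (U : nat -> T -> 'cV[R]_l) :
    Prop :=
  let X := state_process A B W X0 U in
  [/\ forall k, measurable_wrt (natural_filtration X k) (U k),
      forall k, square_integrable (U k) &
      noise_indep W X U].

Definition optimal_stationary_pair n l (A : 'M[R]_n) (B : 'M[R]_(n, l))
    (K : 'M[R]_(l, n)) (SigmaW Sigmas : 'M[R]_n) (W : nat -> T -> 'cV[R]_n)
    (Xs : nat -> T -> 'cV[R]_n) (Us : nat -> T -> 'cV[R]_l) : Prop :=
  [/\ Sigmas = (A + B *m K) *m Sigmas *m (A + B *m K)^T + SigmaW,
      gaussian_vec 0 Sigmas (Xs 0%N),
      forall k w, Xs k.+1 w = (A + B *m K) *m Xs k w + W k w,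
      forall k w, Us k w = K *m Xs k w &
      noise_indep W Xs Us].

Definition stage_cost n l (Q : 'M[R]_n) (Rc : 'M[R]_l)
    (X : T -> 'cV[R]_n) (U : T -> 'cV[R]_l) : \bar R :=
  ('E_Pr[fun w => (normsq Q (X w) + normsq Rc (U w))%R])%E.

Definition lambda_tilde n (P S : 'M[R]_n) (Xs : nat -> T -> 'cV[R]_n)
    (k : nat) (X : T -> 'cV[R]_n) : \bar R :=
  (- 'E_Pr[fun w => (normsq P (X w) - normsq P (X w - Xs k w))%R]
   + 'E_Pr[fun w => normsq S (X w - Xs k w)%R])%E.

End RandomVectors.

(* Main.v *)
(* Write Y = X - Xs and V = U - Us. The noise cancels in the dynamics of Y, so
   Y(k+1) = A Y(k) + B V(k). The Riccati equation completes the square,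
     |x|_Q^2 + |u|_R^2 + |Ax + Bu|_P^2 - |x|_P^2 = |u - Kx|_{R + B^T P B}^2,
   and u - Kx takes the same value at (X, U) and (Y, V) and vanishes at
   (Xs, Us). Hence the two sides of the claim, with
     |(y, v)|_H^2 = |y|_Q^2 + |v|_R^2 + |y|_S^2 - |Ay + Bv|_S^2,
   differ pathwise only by products of the noise with quantities independent of
   it and by |Xs(k+1)|_P^2 - |Xs(k)|_P^2, all of zero mean. It remains to choose
   S > 0 such that H > 0: detectability provides L with A + L Q^(1/2) Schur
   stable, hence contracting for some S0 > 0, and a small multiple S of S0 makes
   |y|_Q^2 + |v|_R^2 dominate what Ay + Bv = (A + L Q^(1/2)) y + (Bv - L Q^(1/2) y)
   adds to the contraction. *)
Require Import Defs.
From HB Require Import structures.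
From mathcomp Require Import all_boot all_order all_algebra.
From mathcomp Require Import complex spectral ring lra.
From mathcomp Require Import all_classical all_reals all_analysis.
From mathcomp Require Import measurable_realfun.

Set Implicit Arguments.
Unset Strict Implicit.
Unset Printing Implicit Defensive.

Import Order.TTheory GRing.Theory Num.Theory.
Import numFieldNormedType.Exports.

Local Open Scope classical_set_scope.
Local Open Scope ring_scope.

(** * Quadratic forms and discrete Lyapunov functions *)

(** Cauchy-Schwarz against the constant vector, from a_i a_j <= (a_i^2 + a_j^2) / 2. The size of [P]
    is relaxed to [n], so that one constant serves every partial sum. *)
Lemma sqr_sum_le (R : realFieldType) n (P : pred 'I_n) (a : 'I_n -> R) :
  (\sum_(i | P i) a i) ^+ 2 <= n%:R * \sum_(i | P i) a i ^+ 2.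
Proof.
have -> : (\sum_(i | P i) a i) ^+ 2 = \sum_(i | P i) \sum_(j | P j) a i * a j.
  by rewrite expr2 mulr_suml; apply: eq_bigr => i _; rewrite mulr_sumr.
have le1 : \sum_(i | P i) \sum_(j | P j) a i * a j <=
    \sum_(i | P i) \sum_(j | P j) (a i ^+ 2 / 2 + a j ^+ 2 / 2).
  apply: ler_sum => i _; apply: ler_sum => j _.
  by have := sqr_ge0 (a i - a j); nra.
apply: (le_trans le1).
set s := \sum_(i | P i) a i ^+ 2.
have s0 : 0 <= s by apply: sumr_ge0 => i _; exact: sqr_ge0.
have cardP : (#|P|%:R : R) <= n%:R.
  by rewrite ler_nat (leq_trans (max_card _)) ?card_ord.
suff -> : \sum_(i | P i) \sum_(j | P j) (a i ^+ 2 / 2 + a j ^+ 2 / 2) =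
    #|P|%:R * s.
  exact: ler_wpM2r.
under eq_bigr do rewrite big_split /= sumr_const -mulr_suml -/s.
rewrite big_split /= sumr_const sumrMnl -mulr_suml -/s.
rewrite -[X in X + _]mulr_natl -[X in _ + X]mulr_natl.
by field.
Qed.

(* The weights decay geometrically, so fast that the entries below the diagonal
   become negligible. *)
Lemma nonneg_trig_contraction (R : realFieldType) n (t : 'M[R]_n) :
  (forall i j, 0 <= t i j) -> is_trig_mx t -> (forall i, t i i < 1) ->
  exists (w : 'I_n -> R) (r : R), [/\ forall i, 0 < w i, 0 < r < 1 &
    forall a : 'cV[R]_n,
      \sum_i w i * (t *m a) i ord0 ^+ 2 <= r * \sum_i w i * a i ord0 ^+ 2].
Proof.
move=> t0 /is_trig_mxP trig t1.
(* The product of the gaps 1 - t_ii is a positive lower bound for each of them and stands in for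
   their minimum. *)
pose p := \prod_i (1 - t i i).
have p0 : 0 < p by apply: prodr_gt0 => i _; rewrite subr_gt0.
have pt i : p <= 1 - t i i.
  rewrite /p (bigD1 i) //= ler_piMr ?subr_ge0 ?(ltW (t1 i)) //.
  by apply: prodr_ile1 => j ?; rewrite subr_ge0 (ltW (t1 j)) /= lerBlDr lerDl.
have p1 : p <= 1.
  by apply: prodr_ile1 => j ?; rewrite subr_ge0 (ltW (t1 j)) /= lerBlDr lerDl.
pose D := n%:R * \sum_i \sum_j t i j ^+ 2.
have D0 : 0 <= D.
  rewrite mulr_ge0 ?ler0n// sumr_ge0// => i _; rewrite sumr_ge0// => j _.
  by rewrite sqr_ge0.
pose G := D / p.
have G0 : 0 <= G by rewrite divr_ge0 // ltW.
(* [e] makes the contribution [G * n * e] from below the diagonal at most [p / 2], half of the gap,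
   which leaves the rate [1 - p / 2]. The summand 1 keeps the denominator positive when [G * n]
   vanishes. *)
pose e := p / 2 / (1 + G * n%:R).
have Gn0 : 0 <= G * n%:R by rewrite mulr_ge0.
have e0 : 0 < e by rewrite !divr_gt0 // ltr_wpDr.
have Ge : G * n%:R * e <= p / 2.
  rewrite /e mulrCA ler_piMr ?divr_ge0 ?(ltW p0)//.
  by rewrite ler_pdivrMr ?mul1r ?lerDr// ltr_wpDr.
have e1 : e <= 1.
  rewrite ler_pdivrMr ?mul1r; last by rewrite ltr_wpDr.
  by lra.
pose b (a : 'cV[R]_n) (i : 'I_n) := \sum_(j < n | (j < i)%N) t i j * a j ord0.
have taE a i : (t *m a) i ord0 = t i i * a i ord0 + b a i.
  rewrite mxE (bigD1 i) //=; congr (_ + _).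
  rewrite /b (bigID (fun j : 'I_n => (j < i)%N)) /= [X in _ + X]big1 ?addr0.
    apply: eq_bigl => j; rewrite ltn_neqAle.
    by case: eqVneq => //= ->; rewrite eqxx.
  move=> j /andP[ji].
  rewrite -leqNgt leq_eqVlt eq_sym val_eqE (negbTE ji) /= => ij.
  by rewrite trig ?mul0r.
have bE a i : b a i ^+ 2 <= D * \sum_(j < n | (j < i)%N) a j ord0 ^+ 2.
  apply: (le_trans (sqr_sum_le _ _)).
  rewrite /D -mulrA ler_wpM2l ?ler0n// mulr_sumr; apply: ler_sum => j _.
  rewrite exprMn ler_wpM2r ?sqr_ge0//.
  rewrite (bigD1 i) //= (bigD1 j) //= -addrA lerDl addr_ge0//.
    by rewrite sumr_ge0// => k _; rewrite sqr_ge0.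
  by rewrite sumr_ge0// => k _; rewrite sumr_ge0// => k' _; rewrite sqr_ge0.
have step (a : 'cV[R]_n) i : (t *m a) i ord0 ^+ 2 <=
    t i i * a i ord0 ^+ 2 + G * \sum_(j < n | (j < i)%N) a j ord0 ^+ 2.
  rewrite taE.
  (* Convexity of the square: t a + b = t a + (1 - t) (b / (1 - t)). *)
  have cvx : (t i i * a i ord0 + b a i) ^+ 2 <=
      t i i * a i ord0 ^+ 2 + b a i ^+ 2 / (1 - t i i).
    have q0 : 0 < 1 - t i i by rewrite subr_gt0.
    have := mulr_ge0 (mulr_ge0 (t0 i i) (ltW q0))
      (sqr_ge0 (a i ord0 - b a i / (1 - t i i))).
    rewrite -subr_ge0 => h; rewrite -subr_ge0 (le_trans h)// le_eqVlt.
    apply/orP; left.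
    by apply/eqP; field; rewrite gt_eqF.
  apply: (le_trans cvx); rewrite lerD2l /G.
  have := bE a i; set s := (\sum_(j < n | _) a j ord0 ^+ 2) => bs.
  have s0 : 0 <= s by rewrite /s sumr_ge0// => j _; rewrite sqr_ge0.
  rewrite [leRHS]mulrAC; apply: ler_pM => //; rewrite ?sqr_ge0//.
    by rewrite invr_ge0 subr_ge0 ltW.
  by rewrite lef_pV2 ?posrE ?subr_gt0.
exists (fun i => e ^+ i), (1 - p / 2); split.
- by move=> i; rewrite exprn_gt0.
- by apply/andP; split; lra.
- move=> a.
  apply: (@le_trans _ _ (\sum_(i < n) e ^+ i * (t i i * a i ord0 ^+ 2 +
      G * \sum_(j < n | (j < i)%N) a j ord0 ^+ 2))).
    by apply: ler_sum => i _; rewrite ler_wpM2l ?step// exprn_ge0// ltW.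
  under eq_bigr do rewrite mulrDr.
  rewrite big_split /=.
  have -> : \sum_(i < n) e ^+ i * (G * \sum_(j < n | (j < i)%N) a j ord0 ^+ 2) =
     \sum_(j < n) a j ord0 ^+ 2 * (G * \sum_(i < n | (j < i)%N) e ^+ i).
    under eq_bigr do rewrite !mulr_sumr.
    under [RHS]eq_bigr do rewrite !mulr_sumr.
    rewrite (exchange_big_dep xpredT) //=.
    apply: eq_bigr => j _; apply: eq_bigr => i _.
    by ring.
  rewrite -big_split /= mulr_sumr; apply: ler_sum => j _.
  (* Only indices beyond [j] occur, so every weight carries at least one extra factor [e]. *)
  have se : \sum_(i < n | (j < i)%N) e ^+ i <= n%:R * (e * e ^+ j).
    apply: (@le_trans _ _ (\sum_(i < n | (j < i)%N) (e * e ^+ j))).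
      by apply: ler_sum => i ji; rewrite -exprS ler_wiXn2l// ltW.
    rewrite sumr_const -[leLHS]mulr_natl; apply: ler_wpM2r.
      by rewrite mulr_ge0 ?exprn_ge0 ?ltW.
    by rewrite ler_nat (leq_trans (max_card _)) ?card_ord.
  have ej : 0 < e ^+ j by rewrite exprn_gt0.
  have aj := sqr_ge0 (a j ord0).
  apply: (@le_trans _ _ (e ^+ j * a j ord0 ^+ 2 * (t j j + G * n%:R * e))).
    have := ler_wpM2l aj (ler_wpM2l G0 se).
    rewrite -(lerD2l (e ^+ j * (t j j * a j ord0 ^+ 2))) => /le_trans; apply.
    by rewrite le_eqVlt; apply/orP; left; apply/eqP; ring.
  rewrite mulrC; apply: ler_wpM2r; first by rewrite mulr_ge0 // ltW.
  by move: Ge (pt j) => /=; move: (G * _ * e) (t j j) => g u; lra.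
Qed.

(** * Algebra of bilinear and quadratic forms, bounds between them *)

Section Forms.
Context {R : realType}.

(** Cross terms pair states with inputs, hence the rectangular matrix. With [1%:M] in the middle
    this is the linear functional a^T x through which Gaussian laws are described. *)
Definition bform n m (M : 'M[R]_(n, m)) (x : 'cV[R]_n) (y : 'cV[R]_m) : R :=
  (x^T *m M *m y) ord0 ord0.

Lemma bform_diag n (M : 'M[R]_n) x : bform M x x = normsq M x.
Proof. by []. Qed.

Lemma bformE n m (M : 'M[R]_(n, m)) x y :
  bform M x y = \sum_i \sum_j M i j * (x i ord0 * y j ord0).
Proof.
rewrite /bform -mulmxA mxE; apply: eq_bigr => i _; rewrite !mxE mulr_sumr.
by apply: eq_bigr => j _; ring.
Qed.

Lemma bformDl n m (M : 'M[R]_(n, m)) x x' y :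
  bform M (x + x') y = bform M x y + bform M x' y.
Proof. by rewrite /bform linearD /= !mulmxDl mxE. Qed.

Lemma bformDr n m (M : 'M[R]_(n, m)) x y y' :
  bform M x (y + y') = bform M x y + bform M x y'.
Proof. by rewrite /bform mulmxDr mxE. Qed.

Lemma bformNl n m (M : 'M[R]_(n, m)) x y : bform M (- x) y = - bform M x y.
Proof. by rewrite /bform linearN /= !mulNmx mxE. Qed.

Lemma bformNr n m (M : 'M[R]_(n, m)) x y : bform M x (- y) = - bform M x y.
Proof. by rewrite /bform mulmxN mxE. Qed.

Lemma bformNmx n m (M : 'M[R]_(n, m)) x y : bform (- M) x y = - bform M x y.
Proof. by rewrite /bform mulmxN mulNmx mxE. Qed.

Lemma bformZl n m a (M : 'M[R]_(n, m)) x y : bform M (a *: x) y = a * bform M x y.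
Proof. by rewrite /bform linearZ /= -!scalemxAl mxE. Qed.

Lemma bformZr n m a (M : 'M[R]_(n, m)) x y : bform M x (a *: y) = a * bform M x y.
Proof. by rewrite /bform -scalemxAr mxE. Qed.

Lemma bform_mulr n m p (M : 'M[R]_(n, m)) (N : 'M[R]_(m, p)) x y :
  bform M x (N *m y) = bform (M *m N) x y.
Proof. by rewrite /bform !mulmxA. Qed.

Lemma bform_mull n m p (M : 'M[R]_(n, m)) (N : 'M[R]_(n, p)) x y :
  bform M (N *m x) y = bform (N^T *m M) x y.
Proof. by rewrite /bform trmx_mul !mulmxA. Qed.

Lemma bformC n m (M : 'M[R]_(n, m)) x y : bform M x y = bform M^T y x.
Proof.
have -> : bform M x y = ((x^T *m M *m y)^T) ord0 ord0 by rewrite mxE.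
by rewrite !trmx_mul trmxK mulmxA.
Qed.

Lemma bform_sym n (M : 'M[R]_n) x y : M^T = M -> bform M x y = bform M y x.
Proof. by rewrite bformC => ->. Qed.

Lemma bformr0 n m (M : 'M[R]_(n, m)) x : bform M x 0 = 0.
Proof. by rewrite /bform mulmx0 mxE. Qed.

Lemma bforml0 n m (M : 'M[R]_(n, m)) y : bform M 0 y = 0.
Proof. by rewrite bformC bformr0. Qed.

Lemma bform_delta n (x : 'cV[R]_n) k : bform 1%:M (delta_mx k ord0) x = x k ord0.
Proof. by rewrite /bform mulmx1 trmx_delta -rowE mxE. Qed.

Lemma normsqE n (M : 'M[R]_n) x :
  normsq M x = \sum_i \sum_j M i j * (x i ord0 * x j ord0).
Proof. exact: bformE. Qed.

Lemma normsqDmx n (M N : 'M[R]_n) x : normsq (M + N) x = normsq M x + normsq N x.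
Proof. by rewrite /normsq mulmxDr mulmxDl mxE. Qed.

Lemma normsqNmx n (M : 'M[R]_n) x : normsq (- M) x = - normsq M x.
Proof. by rewrite /normsq mulmxN mulNmx mxE. Qed.

Lemma normsqZmx n a (M : 'M[R]_n) x : normsq (a *: M) x = a * normsq M x.
Proof. by rewrite /normsq -scalemxAr -scalemxAl mxE. Qed.

Lemma normsqZ n a (M : 'M[R]_n) x : normsq M (a *: x) = a ^+ 2 * normsq M x.
Proof. by rewrite -!bform_diag bformZl bformZr mulrA expr2. Qed.

Lemma normsqN n (M : 'M[R]_n) x : normsq M (- x) = normsq M x.
Proof. by rewrite -!bform_diag bformNl bformNr opprK. Qed.

Lemma normsqD n (M : 'M[R]_n) x y : M^T = M ->
  normsq M (x + y) = normsq M x + normsq M y + 2 * bform M x y.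
Proof.
by move=> sM; rewrite -!bform_diag bformDl !bformDr (bform_sym y x sM); ring.
Qed.

Lemma normsqM n m (M : 'M[R]_n) (N : 'M[R]_(n, m)) x :
  normsq M (N *m x) = normsq (N^T *m M *m N) x.
Proof. by rewrite /normsq trmx_mul !mulmxA. Qed.

Lemma normsq0 n (M : 'M[R]_n) : normsq M 0 = 0.
Proof. by rewrite /normsq mulmx0 mxE. Qed.

Lemma normsq_diag n (w : 'rV[R]_n) x :
  normsq (diag_mx w) x = \sum_i w ord0 i * x i ord0 ^+ 2.
Proof.
rewrite normsqE; apply: eq_bigr => i _; rewrite (bigD1 i) //= big1 ?addr0.
  by rewrite mxE eqxx mulr1n expr2.
by move=> j ji; rewrite mxE eq_sym (negbTE ji) mul0r.
Qed.

Lemma normsq1 n (x : 'cV[R]_n) : normsq 1%:M x = \sum_i x i ord0 ^+ 2.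
Proof.
rewrite -[1%:M]diag_const_mx normsq_diag; apply: eq_bigr => i _.
by rewrite mxE mul1r.
Qed.

Lemma pdmx_ge0 n (M : 'M[R]_n) x : pdmx M -> 0 <= normsq M x.
Proof.
case=> _ M0; have [->|/M0/ltW//] := eqVneq x 0; by rewrite normsq0.
Qed.

Lemma pdmx1 n : pdmx (1%:M : 'M[R]_n).
Proof.
split=> [|x x0]; first exact: trmx1.
rewrite normsq1 lt_neqAle sumr_ge0 ?andbT => [|i _]; last exact: sqr_ge0.
apply: contra x0; rewrite eq_sym psumr_eq0 => [/allP h|i _]; last exact: sqr_ge0.
apply/eqP/matrixP => i j; rewrite ord1 mxE; apply/eqP.
by have := h i (mem_index_enum _); rewrite /= sqrf_eq0.
Qed.

(** Each product of two coordinates is at most the squared norm in absolute value, so the sum of the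
    moduli of the entries bounds the form; adding 1 makes the constant positive. *)
Lemma normsq_le1 n (G : 'M[R]_n) :
  exists2 c, 0 < c & forall x, normsq G x <= c * normsq 1%:M x.
Proof.
exists (1 + \sum_i \sum_j `|G i j|).
  by rewrite ltr_pwDl// sumr_ge0// => i _; rewrite sumr_ge0.
move=> x; rewrite mulrDl mul1r normsqE.
have s0 : 0 <= normsq 1%:M x by apply: pdmx_ge0; exact: pdmx1.
apply: (@le_trans _ _ ((\sum_i \sum_j `|G i j|) * normsq 1%:M x)).
  rewrite mulr_suml; apply: ler_sum => i _.
  rewrite mulr_suml; apply: ler_sum => j _.
  apply: (le_trans (ler_norm _)); rewrite normrM ler_wpM2l//.
  have xk k : x k ord0 ^+ 2 <= normsq 1%:M x.
    rewrite normsq1 (bigD1 k)//= lerDl sumr_ge0// => ? _; exact: sqr_ge0.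
  have := xk i; have := xk j; set s := normsq _ _.
  move: (x i _) (x j _) => a b bs as_.
  rewrite ler_norml; have := sqr_ge0 (a - b); have := sqr_ge0 (a + b); nra.
by rewrite lerDr.
Qed.

Lemma pdmx_unit n (M : 'M[R]_n) : pdmx M -> M \in unitmx.
Proof.
case=> sM M0; rewrite -row_free_unit -kermx_eq0.
apply/rowV0P => v /sub_kermxP vM.
apply/eqP; apply: contraTT isT => v0.
have : 0 < normsq M v^T by apply: M0; rewrite trmx_eq0.
by rewrite /normsq trmxK vM mul0mx mxE ltxx.
Qed.

(* Expands [0 <= normsq M (x - t *: M^-1 x)], with [t] the reciprocal of a bound
   for the form of [M^-1]. *)
Lemma pdmx_coercive n (M : 'M[R]_n) : pdmx M ->
  exists2 c, 0 < c & forall x, normsq 1%:M x <= c * normsq M x.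
Proof.
move=> pM; have [sM _] := pM; have uM := pdmx_unit pM.
have [c c0 cM] := normsq_le1 (invmx M).
exists c => // x.
have := pdmx_ge0 (x - c^-1 *: (invmx M *m x)) pM.
rewrite normsqD// normsqN normsqZ bformNr bformZr bform_mulr mulmxV// bform_diag.
have -> : normsq M (invmx M *m x) = normsq (invmx M) x.
  by rewrite normsqM trmx_inv sM mulVmx// mul1mx.
have := cM x.
move: (normsq (invmx M) x) (normsq M x) (normsq 1%:M x) => i m s ics h.
have : c^-1 ^+ 2 * i <= c^-1 * s.
  rewrite expr2 -mulrA ler_wpM2l ?invr_ge0 ?(ltW c0)//.
  by rewrite ler_pdivrMl.
by rewrite -(ler_pdivrMl _ _ c0); move: h; move: (_ * i) (_ * s) => a b; lra.
Qed.

Lemma normsq_le n (M G : 'M[R]_n) : pdmx M ->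
  exists2 c, 0 < c & forall x, normsq G x <= c * normsq M x.
Proof.
move=> /pdmx_coercive[c c0 h]; have [e e0 k] := normsq_le1 G.
exists (e * c) => [|x]; first exact: mulr_gt0.
by rewrite -mulrA (le_trans (k x))// ler_wpM2l ?h// ltW.
Qed.

(** Convexity of the form, applied to x + y = s (x / s) + (1 - s) (y / (1 - s)). The defect is the
    form at (1 - s) x - s y, divided by s (1 - s). *)
Lemma normsq_add_le n (M : 'M[R]_n) s x y : pdmx M -> 0 < s < 1 ->
  normsq M (x + y) <= normsq M x / s + normsq M y / (1 - s).
Proof.
move=> pM /andP[s0 s1]; have [sM _] := pM; rewrite normsqD//.
have t0 : 0 < 1 - s by rewrite subr_gt0.
have := pdmx_ge0 ((1 - s) *: x - s *: y) pM.
rewrite normsqD// normsqN !normsqZ bformNr bformZl bformZr.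
move: (normsq M x) (normsq M y) (bform M x y) => a b c h.
rewrite -subr_ge0.
have -> : a / s + b / (1 - s) - (a + b + 2 * c) =
    ((1 - s) ^+ 2 * a + s ^+ 2 * b + 2 * - ((1 - s) * (s * c))) / (s * (1 - s)).
  by field; rewrite !gt_eqF.
by rewrite divr_ge0// ltW// mulr_gt0.
Qed.

End Forms.

(** Unitary triangularization over the complex numbers reduces the claim to the triangular matrix of
    the moduli of the entries, whose diagonal lies below 1. A weighted Euclidean norm of the moduli
    of U x then contracts, and its square is a real quadratic form in x. *)
Lemma schur_stable_lyapunov (R : realType) n (M : 'M[R]_n) : schur_stable M ->
  exists (S : 'M[R]_n) (r : R), [/\ pdmx S, 0 < r < 1 &
    forall x, normsq S (M *m x) <= r * normsq S x].
Proof.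
(* Triangularization is available in positive dimension only; in dimension 0 every form vanishes. *)
case: n M => [|n] M stabM.
  exists 0, 2^-1; split.
  - by split=> [|x]; [rewrite trmx0 | rewrite flatmx0 eqxx].
  - by apply/andP; split; lra.
  - by move=> x; rewrite [x]flatmx0 [_ *m _]flatmx0 normsq0 mulr0.
pose Mc := map_mx (real_complex R) M.
have [U unitU] := Schur Mc (ltn0Sn n).
set T := conjmx U Mc => trigT.
have TE : T = U *m Mc *m invmx U by rewrite /T conjymx // invmx_unitary.
have uU : U \in unitmx := unitarymx_unit unitU.
have TU : T *m U = U *m Mc by rewrite TE mulmxKV.
pose t : 'M[R]_n.+1 := \matrix_(i, j) ComplexField.Normc.normc (T i j).
have normcE (z : R[i]) : (ComplexField.Normc.normc z)%:C%C = `|z|.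
  by rewrite normc_def; case: z.
have normc_ge0 (z : R[i]) : 0 <= ComplexField.Normc.normc z.
  by rewrite -lecR normcE normr_ge0.
have normc_sqr (z : R[i]) :
    ComplexField.Normc.normc z ^+ 2 = complex.Re z ^+ 2 + complex.Im z ^+ 2.
  by case: z => a b /=; rewrite sqr_sqrtr// addr_ge0// sqr_ge0.
have t0 i j : 0 <= t i j by rewrite mxE.
have trigt : is_trig_mx t.
  apply/is_trig_mxP => i j ij; move/is_trig_mxP: trigT => /(_ i j ij) Tij.
  by rewrite mxE Tij ComplexField.Normc.normc0.
(* Stability enters here: the diagonal entries of the triangular [T] are roots of its characteristic
   polynomial, hence eigenvalues of [Mc]. *)
have t1 i : t i i < 1.
  rewrite mxE -ltcR normcE; apply: stabM.
  apply: (eigenvalue_conjmx (stablemx_unit _ uU)); first by rewrite row_free_unit.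
  change (is_true (eigenvalue T (T i i))); rewrite eigenvalue_root_char.
  rewrite (char_poly_trig trigT) /root horner_prod (bigD1 i) //=.
  by rewrite !hornerE subrr mul0r.
have [w [r [w0 r01 wr]]] := nonneg_trig_contraction t0 trigt t1.
(* For real x the squared modulus of an entry of U x is the sum of the squares of the entries of
   [Ur] x and [Ui] x, which makes [S] real. *)
pose Ur : 'M[R]_n.+1 := map_mx (@complex.Re R) U.
pose Ui : 'M[R]_n.+1 := map_mx (@complex.Im R) U.
pose D := diag_mx (\row_i w i).
pose a (x : 'cV[R]_n.+1) : 'cV[R]_n.+1 :=
  \col_i ComplexField.Normc.normc ((U *m map_mx (real_complex R) x) i ord0).
pose S := Ur^T *m D *m Ur + Ui^T *m D *m Ui.
have SE x : normsq S x = \sum_i w i * a x i ord0 ^+ 2.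
  rewrite normsqDmx -!normsqM !normsq_diag -big_split /=; apply: eq_bigr => i _.
  rewrite -mulrDr !mxE normc_sqr; congr (_ * (_ ^+ 2 + _ ^+ 2)).
    rewrite raddf_sum; apply: eq_bigr => j _; rewrite !mxE.
    by case: (U i j) => u v /=; rewrite mulr0 subr0.
  rewrite raddf_sum; apply: eq_bigr => j _; rewrite !mxE.
  by case: (U i j) => u v /=; rewrite mulr0 add0r.
exists S, r; split => //.
- split.
    by rewrite /S linearD /= !trmx_mul !trmxK tr_diag_mx !mulmxA.
  move=> x x0; rewrite SE lt_neqAle sumr_ge0 ?andbT; last first.
    by move=> i _; rewrite mulr_ge0 ?sqr_ge0 ?ltW.
  apply: contra x0; rewrite eq_sym psumr_eq0; last first.
    by move=> i _; rewrite mulr_ge0 ?sqr_ge0 ?ltW.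
  move=> /allP h.
  have : U *m map_mx (real_complex R) x = 0.
    apply/matrixP => i j; rewrite ord1 [RHS]mxE.
    have := h i (mem_index_enum _).
    rewrite /= mulf_eq0 gt_eqF//= sqrf_eq0 [a _ _ _]mxE.
    by move/eqP/ComplexField.Normc.eq0_normc.
  move/(congr1 (mulmx (invmx U))); rewrite mulKmx// mulmx0 => /matrixP x0.
  apply/eqP/matrixP => i j; have := x0 i j; rewrite !mxE.
  exact: (@complexI R).
(* Since U M x = T U x, the triangle inequality bounds the moduli of U M x entrywise by [t] applied
   to the moduli of U x. *)
- move=> x; rewrite !SE; apply: le_trans (wr (a x)).
  apply: ler_sum => i _; apply: ler_wpM2l; first exact: ltW.
  rewrite ler_sqr ?nnegrE; last 2 first.
  + by rewrite mxE.
  + by rewrite mxE sumr_ge0// => j _; rewrite !mxE mulr_ge0.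
  rewrite mxE [leRHS]mxE -lecR normcE map_mxM mulmxA -TU -mulmxA mxE.
  apply: (le_trans (ler_norm_sum _ _ _)); rewrite rmorph_sum /=.
  by apply: ler_sum => j _; rewrite !mxE rmorphM /= !normcE normrM.
Qed.

Lemma exists_storage_matrix (R : realType) n l (A : 'M[R]_n) (B : 'M[R]_(n, l))
    (Q C : 'M[R]_n) (Rc : 'M[R]_l) :
  detectable A C -> is_sqrtmx Q C -> psdmx Q -> pdmx Rc ->
  exists (S : 'M[R]_n) (H : 'M[R]_(n + l)), [/\ pdmx S, pdmx H &
    forall y v, normsq H (col_mx y v) =
      normsq Q y + normsq Rc v + normsq S y - normsq S (A *m y + B *m v)].
Proof.
move=> [L stabL] [[sC _] CC] [sQ Q0] pR.
have [S0 [r [pS0 /andP[r0 r1] Sr]]] := schur_stable_lyapunov stabL.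
have [sS0 _] := pS0; have [sR R0] := pR.
have [c c0 Lc] := normsq_le1 (L^T *m S0 *m L).
have [c' c0' Bc] := normsq_le (B^T *m S0 *m B) pR.
(* Any weight strictly between [r] and 1 works: splitting with it degrades the rate only to [r / s],
   still below 1. *)
pose s := (1 + r) / 2.
have s0 : 0 < s by rewrite /s; lra.
have s1 : s < 1 by rewrite /s; lra.
pose k := 2 * (c + c') / (1 - s).
have k0 : 0 < k by rewrite divr_gt0 ?subr_gt0// mulr_gt0// addr_gt0.
have Qnorm y : normsq 1%:M (C *m y) = normsq Q y by rewrite normsqM sC mulmx1 CC.
have growth y v : normsq S0 (A *m y + B *m v) <=
    r / s * normsq S0 y + k * (normsq Q y + normsq Rc v).
  have -> : A *m y + B *m v = (A + L *m C) *m y + (B *m v - L *m (C *m y)).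
    by rewrite mulmxDl -mulmxA addrACA subrr addr0.
  apply: (le_trans (normsq_add_le _ _ pS0 (_ : 0 < s < 1))); first by rewrite s0.
  apply: lerD.
    by rewrite mulrAC ler_pM2r ?invr_gt0.
  rewrite /k mulrAC ler_pM2r ?invr_gt0 ?subr_gt0//.
  have le2 : normsq S0 (B *m v - L *m (C *m y)) <=
      2 * (normsq S0 (B *m v) + normsq S0 (L *m (C *m y))).
    have := pdmx_ge0 (B *m v + L *m (C *m y)) pS0.
    by rewrite !normsqD// normsqN bformNr; lra.
  apply: (le_trans le2); rewrite -mulrA ler_pM2l ?ltr0n// !normsqM.
  have := Bc v; have := Lc (C *m y); rewrite Qnorm -!normsqM.
  have := Q0 y; have := pdmx_ge0 v pR.
  move: (normsq _ _) (normsq _ _) (normsq _ _) (normsq _ _) => q1 q2 q3 q4.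
  by nra.
(* With [e * k] equal to 1/2, the growth term uses up half of the stage cost and the other half
   remains. *)
pose e := (2 * k)^-1.
have e0 : 0 < e by rewrite invr_gt0 mulr_gt0.
have ek : e * k = 2^-1 by rewrite /e; field; rewrite gt_eqF.
pose S := e *: S0.
have sS : S^T = S by rewrite /S linearZ /= sS0.
pose N := row_mx A B.
pose H := block_mx (Q + S) 0 0 Rc - N^T *m S *m N.
have HE y v : normsq H (col_mx y v) =
      normsq Q y + normsq Rc v + normsq S y - normsq S (A *m y + B *m v).
  rewrite /H normsqDmx normsqNmx -normsqM /N mul_row_col; congr (_ - _).
  rewrite /normsq tr_col_mx mul_row_block !mulmx0 add0r addr0 mul_row_col.
  by rewrite mulmxDr mulmxDl !mxE addrAC.
exists S, H; split => //.
  by split=> // x x0; rewrite /S normsqZmx mulr_gt0// pS0.2.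
split.
  rewrite /H linearB /= tr_block_mx !trmx0 sR !trmx_mul trmxK sS mulmxA.
  by rewrite linearD /= sS sQ.
move=> x; rewrite -[x]vsubmxK; move: (usubmx x) (dsubmx x) => y v x0.
rewrite HE /S !normsqZmx.
have rs : r / s < 1 by rewrite ltr_pdivrMr// mul1r /s; lra.
have q0 := Q0 y.
have g : e * normsq S0 (A *m y + B *m v) <=
    e * (r / s) * normsq S0 y + 2^-1 * (normsq Q y + normsq Rc v).
  rewrite -ek -(mulrA e k) -(mulrA e) -mulrDr; apply: ler_wpM2l (growth y v).
  exact: ltW.
(* Strictness has two sources: for y = 0 it comes from [Rc], and otherwise from the gap between
   [r / s] and 1, as [Q] may vanish at y. *)
have [y0|y0] := eqVneq y 0.
  have v0 : v != 0 by apply: contra x0 => /eqP ->; rewrite y0 col_mx0.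
  by move: g; rewrite y0 normsq0 !mulr0 normsq0; have := R0 v v0; lra.
have u0 : 0 < normsq S0 y by rewrite pS0.2.
have := pdmx_ge0 v pR.
have : e * (r / s) * normsq S0 y < e * normsq S0 y.
  by rewrite -mulrA ltr_pM2l// gtr_pMl.
by lra.
Qed.

(** The left side is quadratic in u with leading matrix [G]. The relation G K = - B^T P A makes K x
    its minimizer, and the Riccati equation makes the minimum zero. *)
Lemma riccati_square (R : realType) n l (A : 'M[R]_n) (B : 'M[R]_(n, l))
    (Q P : 'M[R]_n) (Rc : 'M[R]_l) x u :
  pdmx Rc -> psdmx P -> riccati_eq A B Q Rc P ->
  normsq Q x + normsq Rc u + normsq P (A *m x + B *m u) - normsq P x =
  normsq (Rc + B^T *m P *m B) (u - lq_gain A B Rc P *m x).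
Proof.
move=> pR [sP P0] ric; set K := lq_gain A B Rc P; set G := Rc + B^T *m P *m B.
have [sR R0] := pR.
have sG : G^T = G by rewrite /G linearD /= !trmx_mul trmxK sR sP mulmxA.
have pG : pdmx G.
  split=> // z z0; rewrite /G normsqDmx -normsqM.
  by apply: ltr_pwDl; [exact: R0|exact: P0].
have GK : G *m K = - (B^T *m P *m A).
  by rewrite /K /lq_gain -/G mulmxN !mulmxA mulmxV ?mul1mx// pdmx_unit.
have Px : normsq P x = normsq P (A *m x) + normsq Q x +
    bform (A^T *m P *m B *m K) x x.
  rewrite [in LHS]ric -/G normsqDmx normsqNmx normsqDmx -normsqM bform_diag.
  by rewrite /K /lq_gain -/G mulmxN normsqNmx !mulmxA.
have h1 : bform P (A *m x) (B *m u) = bform (B^T *m P *m A) u x.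
  by rewrite bformC sP bform_mulr bform_mull mulmxA.
have h2 : bform (A^T *m P *m B *m K) x x = bform (B^T *m P *m A) (K *m x) x.
  by rewrite bformC bform_mull !trmx_mul trmxK sP !mulmxA.
rewrite normsqD// normsqN bformNr bform_mulr GK.
rewrite -[normsq G (K *m x)]bform_diag bform_mulr GK Px normsqD//.
rewrite /G normsqDmx -normsqM !bformNmx h1 h2.
by ring.
Qed.

(** * Moments of square-integrable and Gaussian vectors *)

Section NormalMoments.
Context {R : realType}.

(** The Radon-Nikodym derivative and [normal_pdf] have the same integral over every measurable set,
    so they agree almost everywhere. *)
Lemma ge0_integral_normal_prob (m s : R) (f : measurableTypeR R -> \bar R) :
  s != 0 ->
  measurable_fun setT f -> (forall x, 0 <= f x)%E ->
  (\int[normal_prob m s]_x f x =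
   \int[lebesgue_measure]_x (f x * (normal_pdf m s x)%:E))%E.
Proof.
move=> s0 mf f0.
have dom := normal_prob_dominates m s.
rewrite -(Radon_Nikodym_SigmaFinite.change_of_variables dom)//.
have mpdf : measurable_fun [set: R] (EFin \o normal_pdf m s).
  by apply/measurable_EFinP; exact: measurable_normal_pdf.
have iRN := Radon_Nikodym_SigmaFinite.f_integrable dom.
apply: ae_eq_integral => //.
- by apply: emeasurable_funM => //; exact: measurable_int iRN.
- by apply: emeasurable_funM.
- apply: ae_eqe_mul2l; apply: integral_ae_eq => //.
  by move=> E _ mE; rewrite -(Radon_Nikodym_SigmaFinite.f_integral dom).
Qed.

(* The Gaussian factor of variance [s^2] is the square of the one of variance
   [2 s^2], so one of the two copies absorbs the quadratic growth. *)
Lemma sqr_normal_pdf_le (m s : R) : s != 0 -> exists2 C, 0 <= C &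
  forall x, x ^+ 2 * normal_pdf m s x <= C * normal_pdf m (Num.sqrt 2 * s) x.
Proof.
move=> s0.
have s20 : 0 < s ^+ 2 by rewrite exprn_even_gt0.
have q20 : Num.sqrt 2 * s != 0 :> R by rewrite mulf_neq0// gt_eqF// sqrtr_gt0.
have pk := normal_peak_gt0 q20.
(* With u half of the Gaussian exponent, x^2 <= 2 (x - m)^2 + 2 m^2 and (x - m)^2 = 4 s^2 u give x^2
   <= D (1 + u) <= D exp u. *)
pose D := 2 * m ^+ 2 + 8 * s ^+ 2.
have D0 : 0 <= D by rewrite addr_ge0// mulr_ge0// ?sqr_ge0// ltW.
exists (D * normal_peak s / normal_peak (Num.sqrt 2 * s)) => [|x].
  by rewrite divr_ge0 ?mulr_ge0 ?normal_peak_ge0.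
rewrite !normal_pdfE//=.
rewrite mulrCA [leRHS]mulrA divfK ?gt_eqF// -[leRHS]mulrA [leRHS]mulrCA.
apply: ler_wpM2l; first exact: normal_peak_ge0.
rewrite /normal_fun.
set u := (x - m) ^+ 2 / (4 * s ^+ 2).
have u0 : 0 <= u by rewrite divr_ge0 ?sqr_ge0// mulr_ge0// ltW.
have -> : - (x - m) ^+ 2 / (s ^+ 2 *+ 2) = - u + - u.
  by rewrite /u -mulr_natr; field.
have -> : - (x - m) ^+ 2 / ((Num.sqrt 2 * s) ^+ 2 *+ 2) = - u.
  by rewrite exprMn sqr_sqrtr ?ler0n// /u -mulr_natr; field.
rewrite expRD mulrA; apply: ler_wpM2r; first exact: expR_ge0.
have xD : x ^+ 2 <= D * (1 + u).
  have -> : D * (1 + u) = D + D * u by ring.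
  have us : 4 * s ^+ 2 * u = (x - m) ^+ 2 by rewrite /u; field.
  have Du : 8 * s ^+ 2 * u <= D * u.
    by rewrite ler_wpM2r// lerDr mulr_ge0// sqr_ge0.
  have dD : 2 * m ^+ 2 <= D by rewrite lerDl mulr_ge0// ltW.
  have e8 : 8 * s ^+ 2 * u = 2 * (x - m) ^+ 2 by rewrite -us; ring.
  have sq : x ^+ 2 + (x - m - m) ^+ 2 = 2 * (x - m) ^+ 2 + 2 * m ^+ 2 by ring.
  rewrite (le_trans _ (lerD dD Du))// e8 addrC -sq lerDl; exact: sqr_ge0.
rewrite expRN ler_pdivrMr ?expR_gt0// (le_trans xD)//.
apply: ler_wpM2l => //; exact: expR_ge1Dx.
Qed.

Lemma normal_prob_sqr_lty (m s : R) : s != 0 ->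
  (\int[normal_prob m s]_x (x ^+ 2)%:E < +oo)%E.
Proof.
move=> s0; have [C C0 pC] := sqr_normal_pdf_le m s0.
rewrite ge0_integral_normal_prob//; last 2 first.
- by apply/measurable_EFinP; exact: measurable_funX.
- by move=> x; rewrite lee_fin sqr_ge0.
apply: (@le_lt_trans _ _ (\int[lebesgue_measure]_x
    (C%:E * (normal_pdf m (Num.sqrt 2 * s) x)%:E))%E).
  apply: ge0_le_integral => //=.
  - by move=> x _; rewrite lee_fin mulr_ge0 ?sqr_ge0 ?normal_pdf_ge0.
  - apply/measurable_EFinP; apply: measurable_funM; first exact: measurable_funX.
    exact: measurable_normal_pdf.
  - apply/measurable_EFinP; apply: measurable_funM => //.
    exact: measurable_normal_pdf.
  - by move=> x _; rewrite -EFinM lee_fin.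
rewrite integralZl//; last exact: integrable_normal_pdf.
by rewrite integral_normal_pdf mule1 ltry.
Qed.

Lemma gauss_law_sqr_lty d (T : measurableType d) (Pr : probability T R)
    (f : T -> R) (m v : R) : measurable_fun [set: T] f -> 0 <= v ->
  (forall D, measurable D -> Pr (f @^-1` D) = gauss_law m v D) ->
  (\int[Pr]_w (f w ^+ 2)%:E < +oo)%E.
Proof.
move=> mf v0 law.
pose g : T -> measurableTypeR R := f.
have mg : measurable_fun [set: T] g := mf.
have sqrE : (\int[Pr]_w (f w ^+ 2)%:E = \int[pushforward Pr g]_x (x ^+ 2)%:E)%E.
  rewrite ge0_integral_pushforward//=.
  - by apply/measurable_EFinP; exact: measurable_funX.
  - by move=> x _; rewrite lee_fin sqr_ge0.
(* Zero variance means a Dirac mass, for which the integral is the square of its location. *)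
rewrite sqrE; have [ve|vn] := eqVneq v 0.
  rewrite (eq_measure_integral (@dirac _ (measurableTypeR R) m R)).
    rewrite integral_dirac//= ?diracT ?mul1e ?ltry//.
    by apply/measurable_EFinP; exact: measurable_funX.
  by move=> D mD _; rewrite [LHS]law// /gauss_law ve eqxx.
rewrite (eq_measure_integral (normal_prob m (Num.sqrt v))).
  by apply: normal_prob_sqr_lty; rewrite gt_eqF// sqrtr_gt0 lt_neqAle eq_sym vn.
by move=> D mD _; rewrite [LHS]law// /gauss_law (negbTE vn).
Qed.

End NormalMoments.

(** * Integrability and real-valued means of quadratic expressions *)

Section Moments.
Context {d : measure_display} {T : measurableType d} {R : realType}.
Context (Pr : probability T R).

Lemma eq_Lfun p (f g : T -> R) : f =1 g -> f \in Lfun Pr p -> g \in Lfun Pr p.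
Proof. by move=> /funext ->. Qed.

Lemma Lfun_add p (f g : T -> R) : (1 <= p)%E ->
  f \in Lfun Pr p -> g \in Lfun Pr p -> (fun w => f w + g w) \in Lfun Pr p.
Proof. by move=> p1; exact: (Lfun_addr_closed Pr p1).2. Qed.

Lemma Lfun_scalel p a (f : T -> R) : (1 <= p)%E ->
  f \in Lfun Pr p -> (fun w => a * f w) \in Lfun Pr p.
Proof.
move=> p1 fp; have [L0 L] := Lfun_submod_closed Pr p1.
by apply: eq_Lfun (L a _ _ fp L0) => w; rewrite /= addr0.
Qed.

Lemma Lfun_sub (f g : T -> R) : f \in Lfun Pr 1 -> g \in Lfun Pr 1 ->
  (fun w => f w - g w) \in Lfun Pr 1.
Proof.
move=> f1 g1; have := Lfun_add (lexx _) f1 (Lfun_scalel (- 1) (lexx _) g1).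
by apply: eq_Lfun => w; rewrite mulN1r.
Qed.

Lemma Lfun_sum p n (F : 'I_n -> T -> R) : (1 <= p)%E ->
  (forall i, F i \in Lfun Pr p) -> (fun w => \sum_i F i w) \in Lfun Pr p.
Proof.
move=> p1 FL; have -> : (fun w => \sum_i F i w) = \sum_i F i.
  by apply/funext => w; rewrite fct_sumE.
apply: (big_ind (fun f : T -> R => f \in Lfun Pr p)) => //.
  by case: (Lfun_submod_closed Pr p1).
exact: (Lfun_addr_closed Pr p1).2.
Qed.

Lemma Lfun_mul (f g : T -> R) : f \in Lfun Pr 2%:E -> g \in Lfun Pr 2%:E ->
  (fun w => f w * g w) \in Lfun Pr 1.
Proof. exact: Lfun2_mul_Lfun1. Qed.

Lemma Lfun_measurable p (f : T -> R) :
  f \in Lfun Pr p -> measurable_fun [set: T] f.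
Proof. by move=> /andP[/[!inE]]. Qed.

Lemma Lfun2_sqr_lty (f : T -> R) : measurable_fun [set: T] f ->
  (\int[Pr]_w (f w ^+ 2)%:E < +oo)%E -> f \in Lfun Pr 2%:E.
Proof.
move=> mf fy; apply/andP; split; first by rewrite inE.
rewrite inE /= /finite_norm unlock poweR_lty//.
apply: le_lt_trans fy; rewrite le_eqVlt; apply/orP; left; apply/eqP.
apply: eq_integral => w _ /=.
by rewrite powR_mulrn ?normr_ge0// -normrX ger0_norm// sqr_ge0.
Qed.

(** A real-valued expectation, so that identities between means are ordinary linear arithmetic;
    [meanK] shows that it is faithful on L^1. *)
Definition mean (f : T -> R) : R := fine ('E_Pr[f])%E.

Lemma meanK (f : T -> R) : f \in Lfun Pr 1 -> ('E_Pr[f])%E = (mean f)%:E.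
Proof. by move=> fL; rewrite /mean fineK// expectation_fin_num. Qed.

Lemma meanD (f g : T -> R) : f \in Lfun Pr 1 -> g \in Lfun Pr 1 ->
  mean (fun w => f w + g w) = mean f + mean g.
Proof.
move=> fL gL; rewrite /mean.
have -> : (fun w => f w + g w) = f \+ g by [].
by rewrite expectationD// fineD// expectation_fin_num.
Qed.

Lemma meanZ a (f : T -> R) : f \in Lfun Pr 1 ->
  mean (fun w => a * f w) = a * mean f.
Proof.
move=> fL; rewrite /mean.
have -> : (fun w => a * f w) = a \o* f by apply/funext => w /=; rewrite mulrC.
by rewrite expectationZl// fineM// expectation_fin_num.
Qed.

Lemma mean0 : mean (fun=> 0) = 0.
Proof. by rewrite /mean (expectation_cst Pr 0). Qed.

Lemma mean_sum n (F : 'I_n -> T -> R) : (forall i, F i \in Lfun Pr 1) ->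
  mean (fun w => \sum_i F i w) = \sum_i mean (F i).
Proof.
elim: n F => [|n IH] F FL.
  rewrite big_ord0 -[RHS]mean0; congr mean.
  by apply/funext => w; rewrite big_ord0.
rewrite big_ord_recr /= -IH// -meanD//; last exact: Lfun_sum.
by congr mean; apply/funext => w; rewrite big_ord_recr.
Qed.

Lemma square_integrableD n (X Y : T -> 'cV[R]_n) :
  square_integrable Pr X -> square_integrable Pr Y ->
  square_integrable Pr (fun w => X w + Y w).
Proof.
move=> X2 Y2 i; apply: eq_Lfun (Lfun_add (lee1n 2) (X2 i) (Y2 i)) => w.
by rewrite mxE.
Qed.

Lemma square_integrableM n m (M : 'M[R]_(m, n)) (X : T -> 'cV[R]_n) :
  square_integrable Pr X -> square_integrable Pr (fun w => M *m X w).
Proof.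
move=> X2 i.
have MX j := Lfun_scalel (M i j) (lee1n 2) (X2 j).
apply: eq_Lfun (Lfun_sum (lee1n 2) MX) => w.
by rewrite mxE.
Qed.

Lemma square_integrableB n (X Y : T -> 'cV[R]_n) :
  square_integrable Pr X -> square_integrable Pr Y ->
  square_integrable Pr (fun w => X w - Y w).
Proof.
move=> X2 /(square_integrableM (- 1%:M)) Y2 i.
by apply: eq_Lfun (square_integrableD X2 Y2 i) => w; rewrite mulNmx mul1mx.
Qed.

Lemma square_integrable_col n m (X : T -> 'cV[R]_n) (Y : T -> 'cV[R]_m) :
  square_integrable Pr X -> square_integrable Pr Y ->
  square_integrable Pr (fun w => col_mx (X w) (Y w)).
Proof.
move=> X2 Y2 i; case: (split_ordP i) => j ->.
  by apply: eq_Lfun (X2 j) => w; rewrite col_mxEu.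
by apply: eq_Lfun (Y2 j) => w; rewrite col_mxEd.
Qed.

Lemma Lfun_bform n m (M : 'M[R]_(n, m)) (X : T -> 'cV[R]_n) (Y : T -> 'cV[R]_m) :
  square_integrable Pr X -> square_integrable Pr Y ->
  (fun w => bform M (X w) (Y w)) \in Lfun Pr 1.
Proof.
move=> X2 Y2; under eq_fun do rewrite bformE.
apply: Lfun_sum => // i; apply: Lfun_sum => // j.
by apply: Lfun_scalel => //; exact: Lfun_mul.
Qed.

Lemma Lfun_normsq n (M : 'M[R]_n) (X : T -> 'cV[R]_n) :
  square_integrable Pr X -> (fun w => normsq M (X w)) \in Lfun Pr 1.
Proof. by move=> X2; exact: Lfun_bform. Qed.

Lemma mean_bform n m (M : 'M[R]_(n, m)) (X : T -> 'cV[R]_n) (Y : T -> 'cV[R]_m) :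
  square_integrable Pr X -> square_integrable Pr Y ->
  mean (fun w => bform M (X w) (Y w)) =
  \sum_i \sum_j M i j * mean (fun w => X w i ord0 * Y w j ord0).
Proof.
move=> X2 Y2; under eq_fun do rewrite bformE.
have XY i j : (fun w => X w i ord0 * Y w j ord0) \in Lfun Pr 1 by exact: Lfun_mul.
have MXY i j : (fun w => M i j * (X w i ord0 * Y w j ord0)) \in Lfun Pr 1.
  exact: Lfun_scalel.
rewrite mean_sum => [|i]; last exact: Lfun_sum.
by apply: eq_bigr => i _; rewrite mean_sum//; apply: eq_bigr => j _; rewrite meanZ.
Qed.

(* Polarization: the second moments of the linear functionals determine the
   second-moment matrix. *)
Lemma mean_normsq_eq n (M : 'M[R]_n) (X Y : T -> 'cV[R]_n) :
  square_integrable Pr X -> square_integrable Pr Y ->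
  (forall a : 'cV[R]_n, mean (fun w => bform 1%:M a (X w) ^+ 2) =
                        mean (fun w => bform 1%:M a (Y w) ^+ 2)) ->
  mean (fun w => normsq M (X w)) = mean (fun w => normsq M (Y w)).
Proof.
move=> X2 Y2 XY.
rewrite (mean_bform M X2 X2) (mean_bform M Y2 Y2).
apply: eq_bigr => i _; apply: eq_bigr => j _; congr (_ * _).
pose e k : 'cV[R]_n := delta_mx k ord0.
have eE k (x : 'cV[R]_n) : bform 1%:M (e k) x = x k ord0 := bform_delta x k.
have polar (Z : T -> 'cV[R]_n) : square_integrable Pr Z ->
    mean (fun w => Z w i ord0 * Z w j ord0) =
    2^-1 * (mean (fun w => bform 1%:M (e i + e j) (Z w) ^+ 2)
    - mean (fun w => bform 1%:M (e i) (Z w) ^+ 2)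
    - mean (fun w => bform 1%:M (e j) (Z w) ^+ 2)).
  move=> Z2.
  have Zkl k l : (fun w => Z w k ord0 * Z w l ord0) \in Lfun Pr 1 by exact: Lfun_mul.
  have -> : (fun w => bform 1%:M (e i) (Z w) ^+ 2) =
      (fun w => Z w i ord0 * Z w i ord0).
    by apply/funext => w; rewrite eE expr2.
  have -> : (fun w => bform 1%:M (e j) (Z w) ^+ 2) =
      (fun w => Z w j ord0 * Z w j ord0).
    by apply/funext => w; rewrite eE expr2.
  have -> : (fun w => bform 1%:M (e i + e j) (Z w) ^+ 2) =
      (fun w => (Z w i ord0 * Z w i ord0 + Z w j ord0 * Z w j ord0) +
                2 * (Z w i ord0 * Z w j ord0)).
    by apply/funext => w; rewrite bformDl !eE; ring.
  rewrite meanD ?Lfun_add ?Lfun_scalel// meanD// meanZ//.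
  by field.
by rewrite (polar _ X2) (polar _ Y2) !XY.
Qed.

End Moments.

(** * Equality of laws, independence and Gaussian functionals *)

Section Laws.
Context {d : measure_display} {T : measurableType d} {R : realType}.
Context (Pr : probability T R).

Lemma mean_same_law (f g : T -> R) (phi : R -> R) :
  measurable_fun [set: T] f -> measurable_fun [set: T] g ->
  measurable_fun [set: R] phi ->
  (forall D, measurable D -> Pr (f @^-1` D) = Pr (g @^-1` D)) ->
  (fun w => phi (f w)) \in Lfun Pr 1 -> (fun w => phi (g w)) \in Lfun Pr 1 ->
  mean Pr (fun w => phi (f w)) = mean Pr (fun w => phi (g w)).
Proof.
move=> mf mg mphi law /Lfun1_integrable fL /Lfun1_integrable gL.
rewrite /mean unlock; congr fine.
have mphi' : measurable_fun [set: R] (EFin \o phi) by exact/measurable_EFinP.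
have pushE h (mh : measurable_fun [set: T] h) :
    Pr.-integrable [set: T] (EFin \o (phi \o h)) ->
    (\int[Pr]_w (phi (h w))%:E = \int[pushforward Pr h]_x (EFin \o phi) x)%E.
  by move=> hL; rewrite (integral_pushforward mh mphi').
rewrite (pushE f)// (pushE g)//.
by apply: eq_measure_integral => D mD _; exact: law.
Qed.

(** Independence makes the joint law the product of the marginal laws, and Fubini factors the
    integral of the product. *)
Lemma mean_indep_mul (f g : T -> R) :
  f \in Lfun Pr 2%:E -> g \in Lfun Pr 2%:E ->
  (forall A B : set R, measurable A -> measurable B ->
    Pr (f @^-1` A `&` g @^-1` B) = (Pr (f @^-1` A) * Pr (g @^-1` B))%E) ->
  mean Pr (fun w => f w * g w) = mean Pr f * mean Pr g.
Proof.
move=> f2 g2 ind.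
have mf := Lfun_measurable f2; have mg := Lfun_measurable g2.
have fin : Pr [set: T] \is a fin_num by exact: fin_num_measure.
have f1 : f \in Lfun Pr 1 := Lfun_subset12 fin f2.
have g1 : g \in Lfun Pr 1 := Lfun_subset12 fin g2.
have fg1 : (fun w => f w * g w) \in Lfun Pr 1 := Lfun_mul f2 g2.
pose X : {RV Pr >-> R} := mfun_Sub (mem_set mf).
pose Y : {RV Pr >-> R} := mfun_Sub (mem_set mg).
pose mu := distribution Pr X; pose nu := distribution Pr Y.
pose h w := (f w, g w).
have mh : measurable_fun [set: T] h by exact: measurable_fun_pair.
pose m (z : R * R) : \bar R := (z.1 * z.2)%:E.
have mm : measurable_fun [set: R * R] m.
  by apply/measurable_EFinP; apply: measurable_funM.
(* The hypothesis gives agreement on rectangles, which determine the product measure. *)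
have prodE A : measurable A -> pushforward Pr h A = (mu \x nu)%E A.
  move=> mA; apply/esym.
  exact: (product_measure_unique (m' := pushforward Pr h)).
have mi : (mu \x nu)%E.-integrable [set: R * R] m.
  apply/integrableP; split=> //.
  have <- : (\int[pushforward Pr h]_z `|m z| = \int[mu \x nu]_z `|m z|)%E.
    by apply: eq_measure_integral => A mA _; exact: prodE.
  rewrite ge0_integral_pushforward//; last exact: measurableT_comp.
  by move/Lfun1_integrable: fg1 => /integrableP[].
have idE (Z : {RV Pr >-> R}) : (Z : T -> R) \in Lfun Pr 1 ->
    (\int[distribution Pr Z]_y y%:E = (mean Pr Z)%:E)%E.
  move=> Z1; rewrite integral_distribution//; last exact/Lfun1_integrable.
  by rewrite -meanK// unlock.
have idi (Z : {RV Pr >-> R}) : (Z : T -> R) \in Lfun Pr 1 ->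
    (distribution Pr Z).-integrable [set: R] (fun y => y%:E).
  move=> /Lfun1_integrable/integrableP[mZ Zy].
  apply/integrableP; split; first exact/measurable_EFinP.
  rewrite ge0_integral_distribution//; exact: measurableT_comp.
apply: EFin_inj; rewrite EFinM -meanK// -(idE X)// -(idE Y)// unlock.
transitivity (\int[pushforward Pr h]_z m z)%E.
  by rewrite integral_pushforward//; apply/Lfun1_integrable.
transitivity (\int[mu \x nu]_z m z)%E.
  by apply: eq_measure_integral => A mA _; exact: prodE.
rewrite -integral12_prod_meas1//.
transitivity (\int[mu]_x (x%:E * (mean Pr Y)%:E))%E.
  apply: eq_integral => x _; rewrite /fubini_F /m /=.
  under eq_integral do rewrite EFinM.
  by rewrite integralZl// ?idE// idi.
rewrite integralZr//; last exact: idi.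
by rewrite !idE.
Qed.

Lemma sigma_vec_coord n (X : T -> 'cV[R]_n) i (A : set R) :
  measurable A -> sigma_vec X ((fun w => X w i ord0) @^-1` A).
Proof.
move=> mA; apply: sub_sigma_algebra; exists i => //=.
by exists A => //; rewrite setTI.
Qed.

Lemma mean_indep_bform n m (M : 'M[R]_(n, m)) (X : T -> 'cV[R]_n)
    (Y : T -> 'cV[R]_m) :
  square_integrable Pr X -> square_integrable Pr Y ->
  (forall i j (A B : set R), measurable A -> measurable B ->
    Pr ((fun w => X w i ord0) @^-1` A `&` (fun w => Y w j ord0) @^-1` B) =
    (Pr ((fun w => X w i ord0) @^-1` A) * Pr ((fun w => Y w j ord0) @^-1` B))%E) ->
  (forall j, mean Pr (fun w => Y w j ord0) = 0) ->
  mean Pr (fun w => bform M (X w) (Y w)) = 0.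
Proof.
move=> X2 Y2 ind Y0; rewrite mean_bform// big1// => i _; rewrite big1// => j _.
by rewrite (mean_indep_mul (X2 i) (Y2 j)) ?Y0 ?mulr0// => A B; exact: ind.
Qed.

Lemma gaussian_square_integrable n mu (S : 'M[R]_n) (X : T -> 'cV[R]_n) :
  gaussian_vec Pr mu S X -> square_integrable Pr X.
Proof.
move=> [mX [_ S0] law] i; apply: Lfun2_sqr_lty; first exact: mX.
pose e : 'cV[R]_n := delta_mx i ord0.
apply: (gauss_law_sqr_lty (m := (e^T *m mu) ord0 ord0) (mX i) (S0 e)) => D mD.
rewrite -law//; congr (Pr (_ @^-1` D)); apply/funext => w.
by rewrite -[LHS]bform_delta /bform mulmx1.
Qed.

Lemma gaussian_same_law n m mu mu' (S : 'M[R]_n) (S' : 'M[R]_m)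
    (X : T -> 'cV[R]_n) (Y : T -> 'cV[R]_m) a b (D : set R) :
  gaussian_vec Pr mu S X -> gaussian_vec Pr mu' S' Y ->
  bform 1%:M a mu = bform 1%:M b mu' -> normsq S a = normsq S' b ->
  measurable D ->
  Pr ((fun w => bform 1%:M a (X w)) @^-1` D) =
  Pr ((fun w => bform 1%:M b (Y w)) @^-1` D).
Proof.
rewrite /bform !mulmx1 => -[_ _ lawX] [_ _ lawY] ab Sab mD.
by rewrite (lawX a D mD) (lawY b D mD) ab Sab.
Qed.

End Laws.

(** * Second moments of centred Gaussian vectors and their stationarity *)

Section Stationarity.
Context {d : measure_display} {T : measurableType d} {R : realType}.
Context (Pr : probability T R).

Lemma Lfun_bform_cst n (a : 'cV[R]_n) (X : T -> 'cV[R]_n) :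
  square_integrable Pr X -> (fun w => bform 1%:M a (X w)) \in Lfun Pr 2%:E.
Proof.
move=> X2; have aX2 := square_integrableM (a^T) X2.
by apply: eq_Lfun (aX2 ord0) => w; rewrite /bform mulmx1.
Qed.

(** For a centred vector this is the variance in direction [a], hence the quadratic form of the
    covariance matrix. *)
Definition second_moment n (X : T -> 'cV[R]_n) (a : 'cV[R]_n) : R :=
  mean Pr (fun w => bform 1%:M a (X w) ^+ 2).

Lemma Lfun_sqr_bform n (a : 'cV[R]_n) (X : T -> 'cV[R]_n) :
  square_integrable Pr X -> (fun w => bform 1%:M a (X w) ^+ 2) \in Lfun Pr 1.
Proof.
move=> X2; have aX2 := Lfun_bform_cst a X2.
by apply: eq_Lfun (Lfun_mul aX2 aX2) => w; rewrite expr2.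
Qed.

Lemma second_momentZ n (X : T -> 'cV[R]_n) c a : square_integrable Pr X ->
  second_moment X (c *: a) = c ^+ 2 * second_moment X a.
Proof.
move=> X2; rewrite /second_moment -meanZ; last exact: Lfun_sqr_bform.
by congr mean; apply/funext => w; rewrite bformZl exprMn.
Qed.

(** By symmetry: opposite functionals of a centred Gaussian vector share their variance and thus
    their law, so the mean equals its own negative. *)
Lemma gaussian_mean0 n (S : 'M[R]_n) (X : T -> 'cV[R]_n) i :
  gaussian_vec Pr 0 S X -> mean Pr (fun w => X w i ord0) = 0.
Proof.
move=> gX; have X2 := gaussian_square_integrable gX.
have X1 a : (fun w => bform 1%:M a (X w)) \in Lfun Pr 1.
  by apply: Lfun_subset12; [exact: fin_num_measure | exact: Lfun_bform_cst].
pose e : 'cV[R]_n := delta_mx i ord0.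
have -> : (fun w => X w i ord0) = (fun w => bform 1%:M e (X w)).
  by apply/funext => w; rewrite bform_delta.
have : mean Pr (fun w => bform 1%:M e (X w)) =
    mean Pr (fun w => bform 1%:M (- e) (X w)).
  apply: (mean_same_law (phi := id)) => //.
  - exact: Lfun_measurable (X1 _).
  - exact: Lfun_measurable (X1 _).
  - move=> D mD; apply: (gaussian_same_law gX gX) => //.
      by rewrite !bformr0.
    by rewrite normsqN.
have -> : (fun w => bform 1%:M (- e) (X w)) =
    (fun w => -1 * bform 1%:M e (X w)).
  by apply/funext => w; rewrite bformNl mulN1r.
by rewrite meanZ//; lra.
Qed.

Lemma gaussian_second_moment_eq n m (S : 'M[R]_n) (S' : 'M[R]_m)
    (X : T -> 'cV[R]_n) (Y : T -> 'cV[R]_m) a b :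
  gaussian_vec Pr 0 S X -> gaussian_vec Pr 0 S' Y -> normsq S a = normsq S' b ->
  second_moment X a = second_moment Y b.
Proof.
move=> gX gY ab; have X2 := gaussian_square_integrable gX.
have Y2 := gaussian_square_integrable gY.
apply: (mean_same_law (phi := fun x => x ^+ 2)).
- exact: Lfun_measurable (Lfun_bform_cst a X2).
- exact: Lfun_measurable (Lfun_bform_cst b Y2).
- exact: measurable_funX.
- by move=> D mD; apply: (gaussian_same_law gX gY); rewrite ?bformr0.
- exact: Lfun_sqr_bform.
- exact: Lfun_sqr_bform.
Qed.

(* After rescaling [a] and [b] by the standard deviations of one another, both
   functionals have the same law: no Gaussian integral has to be evaluated. *)
Lemma gaussian_second_moment_prop n m (S : 'M[R]_n) (S' : 'M[R]_m)
    (X : T -> 'cV[R]_n) (Y : T -> 'cV[R]_m) a b :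
  gaussian_vec Pr 0 S X -> gaussian_vec Pr 0 S' Y ->
  normsq S' b * second_moment X a = normsq S a * second_moment Y b.
Proof.
move=> gX gY; have [_ [_ S0] _] := gX; have [_ [_ S0'] _] := gY.
have X2 := gaussian_square_integrable gX; have Y2 := gaussian_square_integrable gY.
rewrite -[normsq S' b]sqr_sqrtr// -[normsq S a]sqr_sqrtr//.
rewrite -!second_momentZ//.
apply: (gaussian_second_moment_eq gX gY).
by rewrite !normsqZ !sqr_sqrtr// mulrC.
Qed.

(** The zero functional has the same variance, so the two second moments agree. *)
Lemma gaussian_second_moment0 n (S : 'M[R]_n) (X : T -> 'cV[R]_n) a :
  gaussian_vec Pr 0 S X -> normsq S a = 0 -> second_moment X a = 0.
Proof.
move=> gX a0; rewrite (gaussian_second_moment_eq (b := 0) gX gX) ?normsq0//.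
rewrite /second_moment -[RHS](mean0 Pr); congr mean.
by apply/funext => w; rewrite bforml0 expr0n.
Qed.

(** The expectation factors by independence, and the noise is centred. The matrix [N] allows Z to be
    the stacked state and control, the vector from which the noise is assumed independent. *)
Lemma mean_noise_cross n m p (M : 'M[R]_(n, m)) (N : 'M[R]_(n, p))
    (Z : T -> 'cV[R]_p) (V : T -> 'cV[R]_m) (S : 'M[R]_m) :
  square_integrable Pr Z -> gaussian_vec Pr 0 S V -> indep_vec Pr V Z ->
  mean Pr (fun w => bform M (N *m Z w) (V w)) = 0.
Proof.
move=> Z2 gV ind; under eq_fun do rewrite bform_mull.
apply: mean_indep_bform => //; first exact: gaussian_square_integrable gV.
  move=> i j A B mA mB; rewrite setIC muleC.
  by apply: ind; exact: sigma_vec_coord.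
by move=> j; exact: gaussian_mean0 gV.
Qed.

(** Second moments are propagated instead of Gaussian laws. They obey the recursion behind the
    equation for [Sigma], and proportionality to the Gaussian variances makes the initial ones a
    fixed point. *)
Lemma stationary_second_moment n p (M Sigma SigmaW : 'M[R]_n)
    (W X : nat -> T -> 'cV[R]_n) (U : nat -> T -> 'cV[R]_p) :
  Sigma = M *m Sigma *m M^T + SigmaW ->
  gaussian_vec Pr 0 Sigma (X 0%N) -> (forall k, gaussian_vec Pr 0 SigmaW (W k)) ->
  (forall k w, X k.+1 w = M *m X k w + W k w) ->
  (forall k, square_integrable Pr (U k)) -> noise_indep Pr W X U ->
  forall k, square_integrable Pr (X k) /\
    forall a, second_moment (X k) a = second_moment (X 0%N) a.
Proof.
move=> SE gX gW XS U2 ind; elim=> [|k [X2 IH]].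
  by split=> //; exact: gaussian_square_integrable gX.
have W2 := gaussian_square_integrable (gW k).
have XE : X k.+1 = (fun w => M *m X k w + W k w) by apply/funext => w.
split=> [|a].
  by rewrite XE; apply: square_integrableD => //; exact: square_integrableM.
have MX2 := square_integrableM M X2.
have expand : second_moment (X k.+1) a =
    second_moment (X k) (M^T *m a) + second_moment (W k) a.
  rewrite /second_moment XE.
  (* This block row recovers M X from the stacked vector, ignoring the control. *)
  pose N : 'M[R]_(n, n + p) := row_mx M 0.
  have -> : (fun w => bform 1%:M a (M *m X k w + W k w) ^+ 2) =
      (fun w => (bform 1%:M (M^T *m a) (X k w) ^+ 2 + bform 1%:M a (W k w) ^+ 2) +
       2 * bform (a *m a^T) (N *m col_mx (X k w) (U k w)) (W k w)).
    apply/funext => w; rewrite bformDr /N mul_row_col mul0mx addr0.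
    (* The product of the functionals a^T M X and a^T W is the bilinear form of the rank-one matrix
       a a^T. *)
    have -> : bform (a *m a^T) (M *m X k w) (W k w) =
        bform 1%:M a (M *m X k w) * bform 1%:M a (W k w).
      rewrite {1}/bform mulmxA -mulmxA mxE big_ord1 /bform !mulmx1; congr (_ * _).
      have -> : ((M *m X k w)^T *m a) ord0 ord0 =
          (((M *m X k w)^T *m a)^T) ord0 ord0.
        by rewrite [RHS]mxE.
      by rewrite trmx_mul trmxK.
    rewrite bform_mull trmxK mulmx1 [in bform _ a (M *m _)]bform_mulr mul1mx.
    ring.
  have ZU2 := square_integrable_col X2 (U2 k).
  have L1 := Lfun_sqr_bform (M^T *m a) X2; have L2 := Lfun_sqr_bform a W2.
  have L3 := Lfun_bform (a *m a^T) (square_integrableM N ZU2) W2.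
  rewrite meanD ?Lfun_add ?Lfun_scalel// meanD// meanZ//.
  by rewrite (mean_noise_cross _ _ ZU2 (gW k) (ind k)) mulr0 addr0.
rewrite expand IH.
have vE : normsq Sigma a = normsq Sigma (M^T *m a) + normsq SigmaW a.
  by rewrite {1}SE normsqDmx normsqM trmxK.
have [_ [_ S0] _] := gX; have [_ [_ SW0] _] := gW k.
(* At variance zero the proportionality is void, but the equation for [Sigma] forces both
   nonnegative summands of the variance to vanish. Otherwise one multiplies by the variance and
   cancels it. *)
have [v0|v0] := eqVneq (normsq Sigma a) 0.
  have := S0 (M^T *m a); have := SW0 a => w0 m0.
  rewrite (gaussian_second_moment0 gX v0) (gaussian_second_moment0 gX); last by lra.
  by rewrite (gaussian_second_moment0 (gW k)) ?addr0//; lra.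
apply: (mulfI v0); rewrite mulrDr.
rewrite -(gaussian_second_moment_prop a _ gX gX).
rewrite -(gaussian_second_moment_prop a _ gX (gW k)).
by rewrite -mulrDl -vE.
Qed.

End Stationarity.

(** * Dissipation equality: pathwise identity, then expectations *)

Theorem lemma6 (R : realType) (n l : nat)
  (A : 'M[R]_n) (B : 'M[R]_(n, l)) (Q : 'M[R]_n) (Rc : 'M[R]_l)
  (Qhalf P : 'M[R]_n)
  (stabAB : stabilizable A B)
  (pdRc : pdmx Rc)
  (psdQ : psdmx Q)
  (sqrtQ : is_sqrtmx Q Qhalf)
  (detAQ : detectable A Qhalf)
  (psdP : psdmx P)
  (riccP : riccati_eq A B Q Rc P)
  (d : measure_display) (T : measurableType d) (Pr : probability T R)
  (SigmaW : 'M[R]_n) (W : nat -> T -> 'cV[R]_n)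
  (noiseW : iid_gaussian_noise Pr SigmaW W)
  (mu0 : 'cV[R]_n) (Sigma0 : 'M[R]_n) (X0 : T -> 'cV[R]_n)
  (gaussX0 : gaussian_vec Pr mu0 Sigma0 X0)
  (Sigmas : 'M[R]_n) (Xs : nat -> T -> 'cV[R]_n) (Us : nat -> T -> 'cV[R]_l)
  (optXsUs : optimal_stationary_pair Pr A B (lq_gain A B Rc P)
               SigmaW Sigmas W Xs Us) :
  exists (S : 'M[R]_n) (H : 'M[R]_(n + l)),
    [/\ pdmx S, pdmx H &
      forall U : nat -> T -> 'cV[R]_l, control_process Pr A B W X0 U ->
      let X := state_process A B W X0 U in
      forall k : nat,
        (stage_cost Pr Q Rc (X k) (U k) - stage_cost Pr Q Rc (Xs k) (Us k)
         + lambda_tilde Pr P S Xs k (X k)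
         - lambda_tilde Pr P S Xs k.+1 (X k.+1)
         = 'E_Pr[fun w => normsq H (col_mx (X k w - Xs k w)%R
                                           (U k w - Us k w)%R)])%E].
Proof.
have [S [H [pS pH HE]]] := exists_storage_matrix B detAQ sqrtQ psdQ pdRc.
exists S, H; split=> // U [_ U2 indU] X k.
have [_ gW] := noiseW; have [SE gXs XsS UsE indXs] := optXsUs.
set K := lq_gain A B Rc P in optXsUs SE XsS UsE.
set M := A + B *m K in SE XsS.
have [sP _] := psdP.
have W2 j := gaussian_square_integrable (gW j).
have X2 j : square_integrable Pr (X j).
  elim: j => [|j IH]; first exact: gaussian_square_integrable gaussX0.
  apply: (square_integrableD _ (W2 j)).
  by apply: square_integrableD; exact: square_integrableM.
have Xs2 j : square_integrable Pr (Xs j).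
  elim: j => [|j IH]; first exact: gaussian_square_integrable gXs.
  have -> : Xs j.+1 = (fun w => M *m Xs j w + W j w) by apply/funext => w.
  exact: square_integrableD (square_integrableM M IH) (W2 j).
have UsKE j : Us j = (fun w => K *m Xs j w) by apply/funext => w.
have Us2 j : square_integrable Pr (Us j) by rewrite UsKE; exact: square_integrableM.
(* The mean of the form [P] depends on the second moments of [Xs] only, and these are constant in
   time. *)
have qE : mean Pr (fun w => normsq P (Xs k.+1 w)) =
    mean Pr (fun w => normsq P (Xs k w)).
  have st := stationary_second_moment SE gXs gW XsS Us2 indXs.
  apply: mean_normsq_eq => // a.
  by rewrite -!/(second_moment Pr _ a) (st k.+1).2 (st k).2.
have Y2 j := square_integrableB (X2 j) (Xs2 j).
have V2 := square_integrableB (U2 k) (Us2 k).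
have YV2 := square_integrable_col (Y2 k) V2.
pose f1 w := normsq Q (X k w) + normsq Rc (U k w).
pose f2 w := normsq Q (Xs k w) + normsq Rc (Us k w).
pose f3 j w := normsq P (X j w) - normsq P (X j w - Xs j w).
pose f4 j w := normsq S (X j w - Xs j w).
pose f7 w := normsq H (col_mx (X k w - Xs k w) (U k w - Us k w)).
have f1L : f1 \in Lfun Pr 1 by apply: Lfun_add => //; exact: Lfun_normsq.
have f2L : f2 \in Lfun Pr 1 by apply: Lfun_add => //; exact: Lfun_normsq.
have f3L j : f3 j \in Lfun Pr 1 by apply: Lfun_sub; exact: Lfun_normsq.
have f4L j : f4 j \in Lfun Pr 1 by exact: Lfun_normsq.
have f7L : f7 \in Lfun Pr 1 by exact: Lfun_normsq.
rewrite /stage_cost /lambda_tilde -/f1 -/f2.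
rewrite -/(f3 k) -/(f3 k.+1) -/(f4 k) -/(f4 k.+1) -/f7.
(* All integrands lie in L^1, so the claim becomes an identity between real means. *)
rewrite !meanK// -!EFinN -!EFinD; congr EFin.
pose Z w := col_mx (X k w) (U k w); pose Zs w := col_mx (Xs k w) (Us k w).
have Z2 : square_integrable Pr Z := square_integrable_col (X2 k) (U2 k).
have Zs2 : square_integrable Pr Zs := square_integrable_col (Xs2 k) (Us2 k).
pose N := row_mx A B.
(* These are the cross terms with the noise in |X(k+1)|_P^2 and |Xs(k+1)|_P^2; the squares
   |W(k)|_P^2 cancel between the two. *)
pose c1 w := bform P (N *m Z w) (W k w); pose c2 w := bform P (N *m Zs w) (W k w).
have c1L : c1 \in Lfun Pr 1 by exact: Lfun_bform (square_integrableM N Z2) (W2 k).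
have c2L : c2 \in Lfun Pr 1 by exact: Lfun_bform (square_integrableM N Zs2) (W2 k).
have c10 : mean Pr c1 = 0 := mean_noise_cross P N Z2 (gW k) (indU k).
have c20 : mean Pr c2 = 0 := mean_noise_cross P N Zs2 (gW k) (indXs k).
pose q j w := normsq P (Xs j w).
have qL j : q j \in Lfun Pr 1 by exact: Lfun_normsq.
(* Every term stands on the side where its sign is positive, so taking means uses only additivity
   and scaling. *)
have pathwise w : (f1 w + f4 k w + f3 k.+1 w) + q k w + 2 * c2 w =
    (f2 w + f3 k w + f4 k.+1 w) + f7 w + q k.+1 w + 2 * c1 w.
  have := riccati_square (X k w) (U k w) pdRc psdP riccP.
  have := riccati_square (Xs k w) (Us k w) pdRc psdP riccP.
  have := riccati_square (X k w - Xs k w) (U k w - Us k w) pdRc psdP riccP.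
  rewrite -/K.
  have -> : U k w - Us k w - K *m (X k w - Xs k w) = U k w - K *m X k w.
    by rewrite mulmxBr UsE opprB addrA subrK.
  have -> : Us k w - K *m Xs k w = 0 by rewrite UsE subrr.
  rewrite normsq0 => ricY ricXs ricX.
  have XSE : X k.+1 w = (A *m X k w + B *m U k w) + W k w by [].
  have XsSE : Xs k.+1 w = (A *m Xs k w + B *m Us k w) + W k w.
    by rewrite XsS UsE /M mulmxDl mulmxA.
  have YSE : X k.+1 w - Xs k.+1 w = A *m (X k w - Xs k w) + B *m (U k w - Us k w).
    by rewrite XSE XsSE opprD addrACA subrr addr0 !mulmxBr opprD addrACA.
  rewrite /f1 /f2 /f3 /f4 /f7 /c1 /c2 /q HE /Z /Zs /N !mul_row_col.
  rewrite YSE XSE XsSE (normsqD _ (W k w))// (normsqD _ (W k w))//.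
  move: ricY ricXs ricX; lra.
rewrite -!/(q _) in qE.
clearbody f1 f2 f3 f4 f7 c1 c2 q.
have := congr1 (mean Pr) (funext pathwise).
rewrite !(meanD, meanZ) ?Lfun_add ?Lfun_scalel//.
by rewrite c10 c20 qE; lra.
Qed.
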